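(* Let $d\ge1$ be an integer and let $p=(p_0,\dots,p_d)\in\mathcal{D}_d$. Let $X_M$ be a random vector with values in $\{0,1\}^d$ and probability mass function $$f_M(x)=\frac{p_k}{\binom{d}{k}}\quad\text{if } x\in\mathcal{X}_k,\ k=0,\dots,d.$$ Then: 1. $X_M$ maximizes the Shannon entropy over $\mathcal{P}(p)$: $X_M=\operatorname{argmax}_{X\in\mathcal{P}(p)}H(X)$. 2. Every extremal point of $\mathcal{P}(p)$ minimizes the Shannon entropy over $\mathcal{P}(p)$: if $r_1,\dots,r_{n_p}$ are the extremal points of the convex polytope $\mathcal{P}(p)$ and $R_i$ has probability mass function $r_i$, then $H(R_i)=\min_{X\in\mathcal{P}(p)}H(X)$ for each $i=1,\dots,n_p$.
   Context: $\mathcal{D}_d$ is the simplex of probability mass functions $p=(p_0,\dots,p_d)$ on $\{0,\dots,d\}$. $\mathcal{X}_k=\{x\in\{0,1\}^d:\sum_ix_i=k\}$. $\mathcal{P}(p)$ is the set of probability mass functions $f$ on $\{0,1\}^d$ such that, if $X=(X_1,\dots,X_d)$ has probability mass function $f$, then $\sum_{i=1}^dX_i$ has probability mass function $p$; it is a convex polytope in $\mathbb{R}^{2^d}$, and $n_p$ denotes the number of its extremal points. $X\in\mathcal{P}(p)$ means that the probability mass function of $X$ lies in $\mathcal{P}(p)$; random vectors are identified with their distributions. The Shannon entropy of a discrete random variable $W$ with probability mass function $q$ is $H(W)=-\sum_wq_w\log q_w$, with $0\log0=0$. *)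

(* Defs.v *)
From mathcomp Require Import all_boot all_order all_algebra.
From mathcomp Require Import boolp classical_sets reals exp.

Set Implicit Arguments.
Unset Strict Implicit.
Unset Printing Implicit Defensive.

Import Order.TTheory GRing.Theory Num.Theory.

Local Open Scope classical_set_scope.
Local Open Scope ring_scope.

(* Random variables on a finite type T are identified with their mass
   functions, which are vectors of R^T: the codomain R^o (R as a module over
   itself) is what gives {ffun T -> R^o} its vector space structure. *)
Definition pmf (R : realType) (T : finType) : set {ffun T -> R^o} :=
  [set f : {ffun T -> R^o} | (forall x, 0 <= (f x : R)) /\ \sum_x (f x : R) = 1].

Definition simplex (R : realType) (d : nat) : set {ffun 'I_d.+1 -> R^o} :=
  @pmf R 'I_d.+1.

Definition cube (d : nat) : finType := {ffun 'I_d -> bool}.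

Definition layer (d k : nat) : {set cube d} :=
  [set x : cube d | (\sum_(i < d) (x i : nat))%N == k]%SET.

(* If X has mass function f, then X_1 + ... + X_d has mass function sum_law f. *)
Definition sum_law (R : realType) (d : nat) (f : {ffun cube d -> R^o}) :
    {ffun 'I_d.+1 -> R^o} :=
  [ffun k : 'I_d.+1 => \sum_(x in layer d k) f x].

Definition with_sum_law (R : realType) (d : nat)
    (p : {ffun 'I_d.+1 -> R^o}) : set {ffun cube d -> R^o} :=
  [set f : {ffun cube d -> R^o} | pmf f /\ sum_law f = p].

(* Terms with q w = 0 vanish whatever the value of ln 0, so 0 log 0 = 0. *)
Definition entropy (R : realType) (T : finType) (q : {ffun T -> R^o}) : R :=
  - \sum_w (q w : R) * ln (q w : R).

Definition extreme_points (R : realType) (V : lmodType R) (A : set V) : set V :=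
  [set v | A v /\ forall u w (t : R), A u -> A w -> 0 < t -> t < 1 ->
     v = t *: u + (1 - t) *: w -> u = v /\ w = v].

Definition argmax (R : realType) (V : Type) (A : set V) (F : V -> R) : set V :=
  [set v | A v /\ forall u, A u -> F u <= F v].

Definition argmin (R : realType) (V : Type) (A : set V) (F : V -> R) : set V :=
  [set v | A v /\ forall u, A u -> F v <= F u].

(* Main.v *)
Require Import Defs.
From mathcomp Require Import all_boot all_order all_algebra.
From mathcomp Require Import boolp classical_sets reals exp.
From mathcomp Require Import lra.

Set Implicit Arguments.
Unset Strict Implicit.

Import Order.TTheory GRing.Theory Num.Theory.

Local Open Scope classical_set_scope.
Local Open Scope ring_scope.

(** Both halves compare entropy with the pairing of the mass function against a
    function of the number of ones, which takes the same value on all of P(p).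
    Gibbs' inequality against f_M gives the maximum, because ln f_M(x) depends
    only on the number of ones in x. For the minimum, f(x) <= p_k on the layer k
    gives H(X) >= H(p), with equality as soon as f charges at most one point of
    each layer; an extremal point does, since otherwise mass could be moved both
    ways between two charged points of the same layer. *)

(** For positive a this is ln t <= t - 1 at t = b / a, multiplied by a. The implication makes b
    positive as soon as a is, so [ln (b / a)] is a genuine logarithm. *)
Lemma mul_ln_sub_le (R : realType) (a b : R) :
  0 <= a -> 0 <= b -> (b = 0 -> a = 0) -> a * ln b - a * ln a <= b - a.
Proof.
move=> a0 b0 ba; have [->|an0] := eqVneq a 0; first by rewrite !mul0r !subr0.
have a_gt0 : 0 < a by rewrite lt_def an0.
have b_gt0 : 0 < b.
  by rewrite lt_def b0 andbT; apply: contra_neq an0.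
rewrite -mulrBr -ln_div ?posrE//.
have h : ln (b / a) <= b / a - 1.
  have := expR_ge1Dx (ln (b / a)); rewrite lnK ?posrE ?divr_gt0//; lra.
apply: (le_trans (ler_wpM2l a0 h)).
by rewrite mulrBr mulr1 mulrC divfK.
Qed.

(** The bound 1 + y < exp y is strict for y <> 0; with y = ln (b / a), equality forces b / a = 1. *)
Lemma mul_ln_sub_eq (R : realType) (a b : R) :
  0 <= a -> 0 <= b -> (b = 0 -> a = 0) ->
  a * ln b - a * ln a = b - a -> a = b.
Proof.
move=> a0 b0 ba; have [->|an0] := eqVneq a 0.
  by rewrite !mul0r !subr0 => <-.
have a_gt0 : 0 < a by rewrite lt_def an0.
have b_gt0 : 0 < b.
  by rewrite lt_def b0 andbT; apply: contra_neq an0.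
rewrite -mulrBr -ln_div ?posrE// => h.
have /eqP : ln (b / a) = b / a - 1.
  by apply: (mulfI an0); rewrite h mulrBr mulr1 [in RHS]mulrC divfK.
have ba_gt0 : 0 < b / a by rewrite divr_gt0.
have [l0 _|ln0] := eqVneq (ln (b / a)) 0.
  have : b / a = 1 by rewrite -[b / a]lnK ?posrE// l0 expR0.
  by move/(congr1 ( *%R^~ a)); rewrite mul1r divfK.
have := expR_gt1Dx ln0; rewrite lnK ?posrE// => lt /eqP e; lra.
Qed.

(** In the sum of the pointwise bounds the right-hand sides q x - f x cancel, both total masses
    being 1. *)
Lemma gibbs (R : realType) (T : finType) (f q : {ffun T -> R^o}) :
  pmf f -> pmf q -> (forall x, q x = 0 -> f x = 0) ->
  entropy f <= - \sum_x (f x : R) * ln (q x : R).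
Proof.
move=> [f0 f1] [q0 q1] fq; rewrite /entropy lerN2 -subr_le0 -sumrB.
apply: (@le_trans _ _ (\sum_x ((q x : R) - (f x : R)))).
  by apply: ler_sum => x _; apply: mul_ln_sub_le => //; exact: fq.
by rewrite sumrB q1 f1 subrr.
Qed.

Lemma gibbs_eq (R : realType) (T : finType) (f q : {ffun T -> R^o}) :
  pmf f -> pmf q -> (forall x, q x = 0 -> f x = 0) ->
  - \sum_x (f x : R) * ln (q x : R) <= entropy f -> f = q.
Proof.
move=> [f0 f1] [q0 q1] fq; rewrite /entropy lerN2 -subr_ge0 -sumrB => h.
(* The pointwise slack: each [g x] is nonnegative and [h] makes their sum at most 0, so all of them
   vanish. *)
pose g x := ((q x : R) - (f x : R))
  - ((f x : R) * ln (q x : R) - (f x : R) * ln (f x : R)).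
have g0 x : true -> 0 <= g x.
  by move=> _; rewrite subr_ge0; apply: mul_ln_sub_le => //; exact: fq.
have sg : \sum_x g x = 0.
  apply/eqP; rewrite eq_le sumr_ge0// andbT /g sumrB.
  by rewrite sumrB q1 f1 subrr sub0r oppr_le0.
apply/ffunP => x; apply: (@mul_ln_sub_eq R) => //; first exact: fq.
have gx : g x = 0 by exact: (psumr_eq0P g0 sg).
by move/eqP: gx; rewrite subr_eq0 => /eqP.
Qed.

(** Taking supports identifies the layer with the k-element subsets of the index set. *)
Lemma card_layer (d k : nat) : #|layer d k| = 'C(d, k).
Proof.
pose s (x : cube d) : {set 'I_d} := [set i | x i]%SET.
have s_inj : injective s.
  by move=> x y /setP h; apply/ffunP => i; have := h i; rewrite !inE.
have cards x : #|s x| = (\sum_(i < d) x i)%N.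
  by rewrite -sum1_card big_mkcond; apply: eq_bigr => i _; rewrite inE; case: (x i).
rewrite -[d in RHS]card_ord -card_draws -(card_imset _ s_inj).
apply: eq_card => A; rewrite inE; apply/imsetP/idP => [[x]|Ak].
  by rewrite inE => /eqP xk ->; rewrite cards xk.
have sA : s [ffun i => i \in A] = A by apply/setP => i; rewrite inE ffunE.
by exists [ffun i => i \in A] => //; rewrite inE -cards sA.
Qed.

Lemma weight_subproof (d : nat) (x : cube d) : (\sum_(i < d) x i < d.+1)%N.
Proof.
rewrite ltnS -[leqRHS]card_ord -sum1_card.
by apply: leq_sum => i _; exact: leq_b1.
Qed.

Definition weight (d : nat) (x : cube d) : 'I_d.+1 := Ordinal (weight_subproof x).

Lemma in_layer (d : nat) (k : 'I_d.+1) (x : cube d) :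
  (x \in layer d k) = (weight x == k).
Proof. by rewrite inE. Qed.

Section WithSumLaw.
Context {R : realType} {d : nat}.
Implicit Types (p : {ffun 'I_d.+1 -> R^o}) (f r : {ffun cube d -> R^o}).

(** The right-hand side no longer mentions [f]: this is the pairing that is constant on P(p). *)
Lemma sum_weight p f (g : 'I_d.+1 -> R) : sum_law f = p ->
  \sum_x (f x : R) * g (weight x) = \sum_k (p k : R) * g k.
Proof.
move=> <-; rewrite (partition_big (@weight d) predT)//=.
apply: eq_bigr => k _; rewrite ffunE mulr_suml.
by apply: eq_big => [x|x /eqP->//]; rewrite in_layer.
Qed.

Lemma with_sum_law_intro p f : simplex p -> (forall x, 0 <= (f x : R)) ->
  sum_law f = p -> with_sum_law p f.
Proof.
move=> [_ p1] f0 fp; do 2?split => //.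
have := @sum_weight p f (fun=> 1) fp.
by under eq_bigr do rewrite mulr1; under [RHS]eq_bigr do rewrite mulr1; rewrite p1.
Qed.

Lemma with_sum_law_le p f x : with_sum_law p f -> (f x : R) <= p (weight x).
Proof.
move=> [[f0 _] <-]; rewrite ffunE (bigD1 x) ?in_layer//= lerDl.
by apply: sumr_ge0 => y _; exact: f0.
Qed.

Lemma entropy_ge p f : with_sum_law p f -> entropy p <= entropy f.
Proof.
move=> fP; have [[f0 _] fp] := fP.
rewrite /entropy lerN2 -(@sum_weight p f (fun k => ln (p k : R)) fp).
apply: ler_sum => x _; have [->|fx0] := eqVneq (f x) 0; first by rewrite !mul0r.
have fx_gt0 : 0 < (f x : R) by rewrite lt_def fx0 f0.
have fxp := with_sum_law_le x fP.
by rewrite ler_wpM2l ?ler_ln ?posrE// (lt_le_trans fx_gt0).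
Qed.

(** A signed perturbation, moving mass e from y to x, or back when e is negative. *)
Definition transfer (x y : cube d) (e : R) : {ffun cube d -> R^o} :=
  [ffun z => e * (z == x)%:R - e * (z == y)%:R].

Lemma sum_law_transfer r x y e : weight x = weight y ->
  sum_law (r + transfer x y e) = sum_law r.
Proof.
move=> xy; apply/ffunP => k; rewrite !ffunE.
under eq_bigr do rewrite !ffunE.
have s u : \sum_(z in layer d k) e * (z == u)%:R = e * (u \in layer d k)%:R.
  rewrite -mulr_sumr; congr (_ * _); case: (boolP (u \in _)) => uk.
    rewrite (bigD1 u)//= eqxx big1 ?addr0// => z /andP[_ /negPf->//].
  rewrite big1// => z zk; case: eqP => // zu; by rewrite -zu zk in uk.
by rewrite big_split/= sumrB !s !in_layer xy subrr addr0.
Qed.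

Lemma with_sum_law_transfer p r x y (e : R) : simplex p -> with_sum_law p r ->
  weight x = weight y -> `|e| <= r x -> `|e| <= r y ->
  with_sum_law p (r + transfer x y e).
Proof.
move=> pS [[r0 _] rp] xy ex ey; apply: with_sum_law_intro => //.
- move=> z; rewrite !ffunE.
  have := r0 z; move: ex ey; rewrite !ler_norml => /andP[? ?] /andP[? ?].
  by have [->|_] := eqVneq z x; [have [_|_] := eqVneq x y|have [->|_] := eqVneq z y];
    rewrite ?mulr1 ?mulr0 ?subrr ?subr0 ?sub0r ?addr0 //; lra.
- by rewrite sum_law_transfer.
Qed.

Lemma extreme_weight_inj p r x y : simplex p ->
  extreme_points (with_sum_law p) r -> 0 < (r x : R) -> 0 < (r y : R) ->
  weight x = weight y -> x = y.
Proof.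
move=> pS [rP rE] rx ry xy; apply/eqP; apply: contraT => nxy.
(* The largest amount that can be moved in either direction without creating negative mass. *)
pose e : R := Num.min (r x : R) (r y : R).
have e0 : 0 < e by rewrite lt_min rx ry.
have ex : e <= r x by rewrite ge_min lexx.
have ey : e <= r y by rewrite ge_min lexx orbT.
(* [r] is the midpoint of two opposite transfers, so extremality makes the first equal to [r];
   evaluating at x then gives e = 0, a contradiction. *)
have [|||||u _] := rE (r + transfer x y e) (r + transfer x y (- e)) (2%:R^-1).
- by apply: with_sum_law_transfer; rewrite // gtr0_norm.
- by apply: with_sum_law_transfer; rewrite // normrN gtr0_norm.
- lra.
- lra.
- apply/ffunP => z; rewrite !ffunE /GRing.scale /=.
  lra.
move/ffunP/(_ x): u; rewrite !ffunE eqxx (negPf nxy) mulr1 mulr0 subr0.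
by move/eqP; rewrite addrC -subr_eq0 addrK gt_eqF.
Qed.

Lemma entropy_extreme p r : simplex p ->
  extreme_points (with_sum_law p) r -> entropy r = entropy p.
Proof.
move=> pS rE; have [[[r0 _] rp] _] := rE.
rewrite /entropy -(@sum_weight p r (fun k => ln (p k : R)) rp); congr (- _).
apply: eq_bigr => x _; have [->|rx0] := eqVneq (r x) 0; first by rewrite !mul0r.
(* A charged point x is the only charged point of its layer, so it carries all of the layer's
   mass. *)
suff -> : p (weight x) = r x by [].
rewrite -rp ffunE (bigD1 x) ?in_layer// big1 ?[LHS]addr0// => y.
rewrite in_layer => /andP[/eqP yx nyx]; apply/eqP; apply: contraNT nyx => ry0.
apply/eqP/(extreme_weight_inj pS rE) => //; rewrite lt_def.
- by rewrite ry0 r0.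
- by rewrite rx0 r0.
Qed.

End WithSumLaw.

Unset Implicit Arguments.
Set Strict Implicit.

Theorem proposition2p2 (R : realType) (d : nat) (p : {ffun 'I_d.+1 -> R^o})
    (fM : {ffun cube d -> R^o}) :
  (1 <= d)%N ->
  simplex p ->
  (forall (k : 'I_d.+1) (x : cube d), x \in layer d k ->
     fM x = p k / ('C(d, k))%:R) ->
  argmax (with_sum_law p) (@entropy R (cube d)) = [set fM]
  /\
  (forall r : {ffun cube d -> R^o},
     extreme_points (with_sum_law p) r ->
     argmin (with_sum_law p) (@entropy R (cube d)) r).
Proof.
move=> _ pS fMp; split; last first.
  move=> r rE; split=> [|u uP]; first exact: rE.1.
  by rewrite (entropy_extreme pS rE) entropy_ge.
have C0 (k : 'I_d.+1) : 0 < ('C(d, k))%:R :> R.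
  by rewrite ltr0n bin_gt0 -ltnS.
have fME x : fM x = p (weight x) / ('C(d, weight x))%:R.
  by apply: fMp; rewrite in_layer.
have MP : with_sum_law p fM.
  apply: with_sum_law_intro => // [x|].
    by rewrite fME divr_ge0 ?(ltW (C0 _))//; exact: pS.1.
  apply/ffunP => k; rewrite ffunE (eq_bigr _ (fMp k)) sumr_const card_layer.
  by rewrite -[LHS]mulr_natr; apply: (@divfK R); rewrite gt_eqF.
(* Absolute continuity for Gibbs: a zero of [fM] comes from a zero of [p], the binomial being
   nonzero, and [p (weight x)] bounds [f x]. *)
have ac f : with_sum_law p f -> forall x, fM x = 0 -> f x = 0.
  move=> fP x; rewrite fME => /eqP.
  rewrite mulf_eq0 invr_eq0 (gt_eqF (C0 _)) orbF => /eqP px.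
  apply/eqP; rewrite eq_le; apply/andP; split; last exact: fP.1.1.
  by rewrite -px with_sum_law_le.
have cross f : with_sum_law p f ->
    - (\sum_x (f x : R) * ln (fM x : R)) = entropy fM.
  have s g : with_sum_law p g -> \sum_x (g x : R) * ln (fM x : R) =
      \sum_k (p k : R) * ln ((p k : R) / ('C(d, k))%:R).
    move=> [_ gp].
    rewrite -(@sum_weight _ _ p g (fun k => ln ((p k : R) / ('C(d, k))%:R)) gp).
    by apply: eq_bigr => x _; rewrite fME.
  by move=> fP; rewrite /entropy !s.
(* Uniqueness of the maximizer is the equality case of Gibbs; that [fM] is one is the inequality
   itself. *)
apply/seteqP; split=> [f [fP fmax]|_ ->].
  apply: gibbs_eq; [exact: fP.1|exact: MP.1|exact: ac|].
  by rewrite cross// fmax.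
split=> // u uP; rewrite -(cross u)//.
by apply: gibbs; [exact: uP.1|exact: MP.1|exact: ac].
Qed.
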